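(* Let $X$ be a locally compact paracompact non-compact space. Then $$2^{L(X)}\leq\big|\mathcal T_L(X)\big|.$$
   Context: Compact, locally compact and paracompact spaces are assumed Hausdorff. $L(X)$ is the Lindelöf number of $X$ (the least infinite cardinal $\kappa$ such that every open cover of $X$ has a subcover of cardinality at most $\kappa$). For a Tychonoff space $X$, a one-point extension of $X$ is a Tychonoff space $Y$ containing $X$ as a dense subspace such that $Y\setminus X$ is a singleton. Two extensions are identified if there is a homeomorphism between them fixing $X$ pointwise. $\mathcal T(X)$ is the set of all (equivalence classes of) one-point extensions of $X$, and $\mathcal T_L(X)=\{Y\in\mathcal T(X): Y\text{ is Lindelöf}\}$. *)

(* Defs.v *)
From HB Require Import structures.
From mathcomp Require Import all_boot all_order all_algebra all_classical.
From mathcomp Require Import topology urysohn.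

Set Implicit Arguments.
Unset Strict Implicit.
Unset Printing Implicit Defensive.

Local Open Scope classical_set_scope.
Local Open Scope card_scope.

Definition open_cover (X : topologicalType) (U : set (set X)) : Prop :=
  U `<=` open /\ \bigcup_(A in U) A = [set: X].

Definition refines (X : Type) (V U : set (set X)) : Prop :=
  forall B, V B -> exists2 A, U A & B `<=` A.

Definition locally_finite (X : topologicalType) (V : set (set X)) : Prop :=
  forall x : X, exists2 N, nbhs x N & finite_set [set B | V B /\ B `&` N !=set0].

Definition paracompact_space (X : topologicalType) : Prop :=
  hausdorff_space X /\
  forall U : set (set X), open_cover U ->
    exists V, [/\ open_cover V, refines V U & locally_finite V].

Definition locally_compact_space (X : topologicalType) : Prop :=
  hausdorff_space X /\ locally_compact [set: X].

Definition tychonoff_space (X : topologicalType) : Prop :=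
  hausdorff_space X /\ completely_regular_space X.

(* Cardinals are represented by sets, and compared with [#<=]. *)
Definition subcover_bound (X : topologicalType) (T : Type) (A : set T) : Prop :=
  forall U : set (set X), open_cover U ->
    exists V, [/\ V `<=` U, open_cover V & V #<= A].

Definition lindelof_space (X : topologicalType) : Prop :=
  subcover_bound X [set: nat].

Definition is_lindelof_number (X : topologicalType) (T : Type) (A : set T) :=
  [/\ infinite_set A, subcover_bound X A &
      forall (T' : Type) (A' : set T'),
        infinite_set A' -> subcover_bound X A' -> A #<= A'].

(* Cardinals are well-ordered. *)
Lemma card_le_least (I T : Type) (A : I -> set T) :
  inhabited I -> exists i, forall j, A i #<= A j.
Proof.
move=> [i0].
pose P (S : set (I -> T)) := (forall f, S f -> forall i, A i (f i)) /\
  (forall f g i, S f -> S g -> f i = g i -> f = g).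
have [S [[SA Sinj] Smax]] : exists S, P S /\ forall S', S `<` S' -> ~ P S'.
  apply: Zorn_bigcup => F FP Ftot; split.
    by move=> f [S FS Sf]; have [/(_ f Sf)] := FP _ FS.
  move=> f g i [S FS Sf] [S' FS' S'g].
  case: (Ftot _ _ FS FS') => sub.
    by have [_] := FP _ FS'; apply=> //; apply: sub.
  by have [_] := FP _ FS; apply=> //; apply: sub.
have [i Hi] : exists i, forall a, A i a -> exists2 f, S f & f i = a.
  apply: contrapT => /forallNP nS.
  have /choice[h Hh] : forall i, exists a, A i a /\ forall f, S f -> f i <> a.
    move=> i; have /existsNP[a /not_implyP[Aa na]] := nS i.
    by exists a; split=> // f Sf fa; apply: na; exists f.
  apply: (Smax (S `|` [set h])).
    split; first by move=> f; left.
    move=> /(_ h (or_intror erefl)) Sh.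
    by have [_ /(_ h Sh)] := Hh i0.
  split=> [f [|->]|f g i [Sf|->] [Sg|->]] //.
  - by move=> Sf i; exact: SA.
  - by move=> i; have [] := Hh i.
  - exact: Sinj.
  - by have [_ /(_ f Sf)] := Hh i.
  - by have [_ /(_ g Sg)/[swap]->] := Hh i.
exists i => j; apply: (@card_le_trans _ _ _ S).
  apply: (@card_le_trans _ _ _ ((fun f => f i) @` S)); last exact: card_image_le.
  by apply: subset_card_le => a /Hi.
apply: (@card_le_trans _ _ _ ((fun f => f j) @` S)).
  by rewrite (card_le_eqr (inj_card_eq _)) // => f g /[!inE] Sf Sg; exact: Sinj.
by apply: subset_card_le => _ [f /SA Sf <-].
Qed.

Lemma inj_card_leT (T U : Type) (f : T -> U) (A : set T) :
  injective f -> A #<= [set: U].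
Proof.
move=> fI.
have [g] : $|{injfun A >-> [set: U]}|.
  by apply/injfunPex; exists f => // x y _ _; exact: fI.
exact: inj_card_le.
Qed.

Lemma card_le_represent (T U : Type) (A : set T) :
  A #<= [set: U] -> exists B : set U, A #<= B /\ B #<= A.
Proof.
move=> /card_leP[f]; exists ((sval \o f) @` [set: A]).
have fI : set_inj [set: A] (sval \o f).
  by move=> x y xT yT /val_inj; exact: (inj xT yT).
split; last first.
  by apply: (card_le_trans (card_image_le _ _)); rewrite (card_le_eql (card_setT _)).
by rewrite (card_le_eqr (inj_card_eq fI)) (card_le_eqr (card_setT _)).
Qed.

Lemma card_le_total (T U : Type) (A : set T) (B : set U) :
  A #<= B \/ B #<= A.
Proof.
pose F (b : bool) : set (T + U) := if b then inl @` A else inr @` B.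
have inlE : (inl @` A : set (T + U)) #= A by apply: inj_card_eq => x y _ _ [].
have inrE : (inr @` B : set (T + U)) #= B by apply: inj_card_eq => x y _ _ [].
have [[] /= least] := card_le_least F (inhabits true).
  left; have := least false.
  by rewrite /F (card_le_eql inlE) (card_le_eqr inrE).
right; have := least true.
by rewrite /F (card_le_eql inrE) (card_le_eqr inlE).
Qed.

(* The carrier [set X + nat] is large enough to represent this cardinal. *)
Lemma lindelof_number_exists (X : topologicalType) :
  exists A : set (set X + nat), is_lindelof_number X A.
Proof.
pose D := {A : set (set X + nat) | infinite_set A /\ subcover_bound X A}.
have gT : infinite_set [set: set X + nat] /\
          subcover_bound X [set: set X + nat].
  split; first by apply/infiniteP; apply: (@inj_card_leT _ _ inr) => x y [].
  move=> U oU; exists U; split=> //.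
  by apply: (@inj_card_leT _ _ inl) => x y [].
have [[A [Ai Ac]] Amin] := card_le_least (fun d : D => sval d)
  (inhabits (exist _ _ gT)).
exists A; split=> // T' A' A'i A'c.
have [|/card_le_represent[B [A'B BA']]] :=
    card_le_total [set: set X + nat] A'.
  exact/card_le_trans/card_leT.
apply: card_le_trans BA'.
suff gB : infinite_set B /\ subcover_bound X B by exact: (Amin (exist _ _ gB)).
split; first by apply/infiniteP/(card_le_trans _ A'B); exact/infiniteP.
move=> U /A'c[V [VU oV VA']]; exists V; split=> //.
exact: card_le_trans A'B.
Qed.

Definition lindelof_number (X : topologicalType) : set (set X + nat) :=
  sval (cid (lindelof_number_exists X)).
Arguments lindelof_number : clear implicits.

Lemma lindelof_numberP (X : topologicalType) :
  is_lindelof_number X (lindelof_number X).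
Proof. exact: svalP (cid (lindelof_number_exists X)). Qed.

Definition embedding (X Y : topologicalType) (e : X -> Y) : Prop :=
  injective e /\
  forall U : set X, open U <-> exists2 V : set Y, open V & U = e @^-1` V.

Record one_point_extension (X : topologicalType) := OnePointExtension {
  ope_space :> topologicalType;
  ope_in : X -> ope_space;
  ope_tychonoff : tychonoff_space ope_space;
  ope_embedding : embedding ope_in;
  ope_dense : dense (range ope_in);
  ope_point : exists p, ~` range ope_in = [set p]
}.

Definition ope_equiv (X : topologicalType) (Y Z : one_point_extension X) :=
  exists (f : Y -> Z) (g : Z -> Y),
    [/\ continuous f, continuous g, cancel f g, cancel g f &
        forall x, f (ope_in Y x) = ope_in Z x].

(* A topological space is a structure on a type, so the one-point extensions  *)
(* form a type too large for [set] and [#<=]; a set of equivalence classes is  *)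
(* therefore written as a plain predicate, and cardinalities are compared by   *)
(* [large_card_le].                                                            *)
Definition lindelof_ope_classes (X : topologicalType)
    (C : one_point_extension X -> Prop) : Prop :=
  exists2 Y : one_point_extension X, lindelof_space Y & C = ope_equiv Y.

(* The function is total on [T], which is harmless as soon as [A] is nonempty. *)
Definition large_card_le (T U : Type) (A : T -> Prop) (B : U -> Prop) : Prop :=
  exists f : T -> U, (forall x, A x -> B (f x)) /\
    (forall x y, A x -> A y -> f x = f y -> x = y).

(* Main.v *)
From HB Require Import structures.
Require Import Defs.
From mathcomp Require Import all_boot all_classical.
From mathcomp Require Import finmap topology urysohn.

(** Let L be the Lindelöf number of X. The extensions are all built on the set
    X + {p}. Given an infinite closed discrete set A in X, an open set U of X
    together with p is declared to be open when U contains all but finitely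
    many points of A and when the complement of U is covered by countably many
    compact sets. The second condition makes the extension Lindelöf: a
    neighbourhood of p leaves out only a set which countably many members of
    any open cover suffice to cover. Since X is paracompact it is normal, and
    normality passes to the extension ([along_normal]): a closed set missing p
    sits, by local compactness, in an open set still covered by countably many
    compact sets, and can be separated inside it from any disjoint closed set
    and from the points of A that it misses. The extension is therefore Tychonoff, and p
    is not isolated because A is infinite.

    The extension remembers A up to finite sets, at least from the countable
    side: if A \ A' contains an infinite countable closed set B, then the
    complement of B is a neighbourhood of p for A' but not for A, and the two
    extensions are inequivalent ([continuous_along_finite]). So it suffices to
    find 2^L subsets A of one closed discrete set D which differ pairwise by
    infinite sets.

    For this, D must have at least L points. Take a locally finite open cover
    of X by relatively compact sets and choose a point in each member. These
    points form a closed discrete set D, infinite since X is not compact. Each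
    point is chosen for finitely many members only, whose union is relatively
    compact; hence X is covered by compact sets indexed by D, every open cover
    has a subcover indexed by the product of D and nat, and so L <= |D x nat|
    ([exists_large_closed_discrete]). As |D x nat| = |D| for the infinite set
    D ([card_le_setX_nat]), also |L x nat| <= |D|, and D contains pairwise
    disjoint sequences (j (l, n))_n indexed by l in L. To a subset S of L one
    associates all the even terms of all these sequences, together with the odd
    terms of the sequences with index in S: two distinct subsets then give sets
    which differ by at least the odd terms of one sequence. *)

Set Implicit Arguments.
Unset Strict Implicit.
Unset Printing Implicit Defensive.

Local Open Scope classical_set_scope.
Local Open Scope card_scope.

(** * Paracompact spaces are normal *)

(** Only finitely many members of the family come near a given point, and
    finite unions commute with closure. *)
Lemma locally_finite_closure_bigcup (X : topologicalType)
    (V W : set (set X)) : locally_finite V -> W `<=` V ->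
  closure (\bigcup_(B in W) B) `<=` \bigcup_(B in W) closure B.
Proof.
move=> lfV WV p clp; have [N Np finN] := lfV p.
pose F := [set B | W B /\ B `&` N !=set0].
have finF : finite_set F.
  by apply: sub_finite_set finN => B [/WV VB BN].
apply: contrapT => np; pose M := \bigcup_(B in F) closure B.
have nM : nbhs p (N `&` ~` M).
  apply: filterI => //; apply: open_nbhs_nbhs; split.
    by rewrite openC; apply: closed_bigcup => // B _; exact: closed_closure.
  by move=> [B [WB _] clB]; apply: np; exists B.
have [q [[B WB Bq] [Nq nMq]]] := clp _ nM.
apply: nMq; exists B; last exact: subset_closure.
by split=> //; exists q.
Qed.

(** Pointwise separation becomes uniform. Refine the cover made of the
    separating neighbourhoods and of the complement of [C] to a locally finite
    one, and take the union of the members that meet [C]. Its closure is the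
    union of their closures, each of which misses [B]. *)
Lemma paracompact_separation (X : topologicalType) (C B : set X) :
  paracompact_space X -> closed C ->
  (forall y, C y -> exists U, [/\ open U, U y & closure U `&` B = set0]) ->
  exists W, [/\ open W, C `<=` W & closure W `&` B = set0].
Proof.
move=> [_ pcX] clC sepC.
pose U := [set A | open A /\ (closure A `&` B = set0 \/ A `&` C = set0)].
have /pcX[V [[oV covV] refV lfV]] : open_cover U.
  split; first by move=> A [].
  apply/seteqP; split=> // y _; have [Cy|nCy] := pselect (C y).
    by have [A [oA Ay AB]] := sepC _ Cy; exists A => //; split=> //; left.
  exists (~` C) => //; split; first exact: closed_openC.
  by right; rewrite setICl.
pose W := [set A | V A /\ A `&` C !=set0].
exists (\bigcup_(A in W) A); split.
- by apply: bigcup_open => A [/oV].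
- move=> y Cy; have : [set: X] y by [].
  rewrite -covV => -[A VA Ay]; exists A => //; split=> //.
  by exists y.
- apply/disjoints_subset => y.
  have WV : W `<=` V by move=> A [].
  move=> /(locally_finite_closure_bigcup lfV WV)[A [VA [z [Az Cz]]] clAy] By.
  have [D [oD]] := refV _ VA; case=> [DB|DC] AD.
    have : (closure D `&` B) y by split=> //; exact: (closureS AD).
    by rewrite DB.
  have : (D `&` C) z by split=> //; exact: AD.
  by rewrite DC.
Qed.

(** Two applications of the separation lemma: the Hausdorff property separates
    points from a point, hence closed sets from a point, hence closed sets from
    closed sets. *)
Lemma paracompact_normal (X : topologicalType) :
  paracompact_space X -> normal_space X.
Proof.
move=> pcX; have [hX _] := pcX.
have reg (x : X) (E : set X) : closed E -> ~ E x ->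
    exists U, [/\ open U, U x & closure U `&` E = set0].
  move=> clE nEx.
  have [|W [oW EW Wx]] := @paracompact_separation X E [set x] pcX clE.
    move=> y Ey; have : y != x by apply/eqP => yx; apply: nEx; rewrite -yx.
    move: hX; rewrite open_hausdorff => /[apply].
    case=> [[U V]] /= [/set_mem Uy /set_mem Vx] [oU oV /eqP UV0].
    exists U; split=> //; apply/disjoints_subset => z clUz /= zx.
    have [|t UVt] := clUz V.
      by rewrite zx; exact: open_nbhs_nbhs.
    by rewrite UV0 in UVt.
  exists (~` closure W); split.
  - by rewrite openC; exact: closed_closure.
  - by move=> clWx; have : (closure W `&` [set x]) x by []; rewrite Wx.
  - apply/disjoints_subset => z clz Ez.
    have [t [nt Wt]] := clz W (open_nbhs_nbhs (conj oW (EW _ Ez))).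
    by apply: nt; exact: subset_closure.
move=> C clC N /set_nbhsP[O [oO CO ON]].
have [|W [oW CW WO]] := @paracompact_separation X C (~` O) pcX clC.
  by move=> y /CO Oy; apply: reg; [exact: open_closedC | by apply].
exists W; first by apply/set_nbhsP; exists W; split.
by apply: subset_trans ON; rewrite -[O]setCK; apply/disjoints_subset.
Qed.

Lemma normal_shrink (X : topologicalType) (C N : set X) : normal_space X ->
  closed C -> open N -> C `<=` N ->
  exists W, [/\ open W, C `<=` W & closure W `<=` N].
Proof.
move=> nX clC oN CN; have [|B /set_nbhsP[W [oW CW WB]] BN] := nX C clC N.
  by apply/set_nbhsP; exists N; split.
by exists W; split=> //; apply: subset_trans BN; exact: closureS.
Qed.

Lemma normal_T1_tychonoff (X : topologicalType) :
  normal_space X -> (forall x : X, closed [set x]) -> tychonoff_space X.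
Proof.
move=> nX T1; split; last first.
  move=> x B clB nBx; apply: normal_uniform_separator => //.
  by apply/disjoints_subset => _ ->.
move=> p q clpq; apply: contrapT => pq.
have [||W [oW pW Wq]] := @normal_shrink X [set p] (~` [set q]) nX (T1 p).
- by rewrite openC.
- by move=> _ ->.
apply: (Wq q) => // N Nq; apply: clpq => //.
by apply: open_nbhs_nbhs; split=> //; exact: pW.
Qed.

(** * Countable unions of compact sets *)

(** A nonempty compact set provides the base point that [compact_cover] asks
    for. *)
Lemma compact_cover_compact (X : topologicalType) (K : set X) :
  compact K -> cover_compact K.
Proof.
have [->|/set0P[x _]] := eqVneq K set0.
  by move=> _ I D f _ _; exists fset0.
pose pX : ptopologicalType := HB.pack (X : Type) X (isPointed.Build X x).
have := @compact_cover pX; rewrite funeqE => /(_ K) cE cK.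
have : @cover_compact pX K by rewrite -cE.
by [].
Qed.

Lemma compact_seq_subcover (X : topologicalType) (U : set (set X)) (K : set X) :
  open_cover U -> U !=set0 -> compact K ->
  exists2 u : nat -> set X, (forall n, U (u n)) & K `<=` \bigcup_n u n.
Proof.
move=> [oU covU] [U0 UU0] /compact_cover_compact cK.
have [||D DU KD] := cK _ U id; first by move=> A /oU.
  by move=> x _; rewrite /cover covU.
exists (nth U0 (enum_fset D)).
  move=> n; have [ltn|gen] := ltnP n (size (enum_fset D)); last first.
    by rewrite nth_default.
  by apply/set_mem/DU; exact: mem_nth.
move=> x /KD[A /= DA Ax]; exists (index A (enum_fset D)) => //.
by rewrite nth_index.
Qed.

Definition sigma_bounded (X : topologicalType) (A : set X) :=
  exists2 K : nat -> set X, (forall n, compact (K n)) & A `<=` \bigcup_n K n.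

Lemma sub_sigma_bounded (X : topologicalType) (A B : set X) :
  A `<=` B -> sigma_bounded B -> sigma_bounded A.
Proof. by move=> AB [K cK BK]; exists K => //; exact: subset_trans BK. Qed.

Lemma sigma_boundedU (X : topologicalType) (A B : set X) :
  sigma_bounded A -> sigma_bounded B -> sigma_bounded (A `|` B).
Proof.
move=> [K cK AK] [L cL BL]; exists (fun n => K n `|` L n).
  by move=> n; exact: compactU.
by move=> x [/AK|/BL] [n _ ?]; exists n => //; [left|right].
Qed.

Lemma range_sigma_bounded (X : topologicalType) (f : nat -> X) :
  sigma_bounded (range f).
Proof.
exists (fun n => [set f n]); first by move=> n; exact: compact_set1.
by move=> _ [n _ <-]; exists n.
Qed.

Lemma compact_bigcup_finite (X : topologicalType) (I : choiceType)
    (D : set I) (K : I -> set X) :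
  finite_set D -> (forall i, D i -> compact (K i)) ->
  compact (\bigcup_(i in D) K i).
Proof.
move=> finD cK; rewrite -bigsetU_fset_set// big_seq.
by apply: bigsetU_compact => i; rewrite in_fset_set// => /set_mem /cK.
Qed.

Lemma locally_compact_nbhs (X : topologicalType) (x : X) :
  locally_compact [set: X] -> exists2 K, nbhs x K & compact K.
Proof.
by move=> /(_ x I)[K]; rewrite withinET => xK [cK _]; exists K.
Qed.

Lemma locally_compact_compact_nbhs (X : topologicalType) (K : set X) :
  locally_compact [set: X] -> compact K ->
  exists U L, [/\ open U, compact L, K `<=` U & U `<=` L].
Proof.
move=> lcX /compact_cover_compact cK.
have /choice[N HN] : forall x : X, exists N, nbhs x N /\ compact N.
  by move=> x; have [N ? ?] := locally_compact_nbhs x lcX; exists N.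
have [||D _ KD] := cK _ [set: X] (fun x => (N x)°).
- by move=> x _; exact: open_interior.
- by move=> x _; exists x => //; have [/nbhs_interior/nbhs_singleton] := HN x.
pose E := [set x : X | x \in D].
exists (\bigcup_(x in E) (N x)°), (\bigcup_(x in E) N x); split=> //.
- by apply: bigcup_open => x _; exact: open_interior.
- apply: compact_bigcup_finite; first exact: finite_fset.
  by move=> x _; have [] := HN x.
- by apply: subset_bigcup => x _; exact: interior_subset.
Qed.

(** Room for separation around a closed set that misses the point at infinity:
    enlarge each of the countably many compact sets to a compact
    neighbourhood. *)
Lemma sigma_bounded_nbhs (X : topologicalType) (A : set X) :
  locally_compact [set: X] -> sigma_bounded A ->
  exists U, [/\ open U, A `<=` U & sigma_bounded U].
Proof.
move=> lcX [K cK AK].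
have /choice[U HU] : forall n, exists U,
    [/\ open U, K n `<=` U & exists2 L, compact L & U `<=` L].
  move=> n; have [U [L [? ? ? ?]]] := locally_compact_compact_nbhs lcX (cK n).
  by exists U; split=> //; exists L.
have /choice[L HL] : forall n, exists L, compact L /\ U n `<=` L.
  by move=> n; have [_ _ [L ? ?]] := HU n; exists L.
exists (\bigcup_n U n); split.
- by apply: bigcup_open => n _; have [] := HU n.
- by apply: subset_trans AK _; apply: subset_bigcup => n _; have [] := HU n.
- exists L; first by move=> n; have [] := HL n.
  by apply: subset_bigcup => n _; have [] := HL n.
Qed.

(** * Closed discrete sets *)

(** In a Hausdorff space, these are the closed discrete sets. *)
Definition locally_finite_set (X : topologicalType) (A : set X) :=
  forall x : X, exists2 N, nbhs x N & finite_set (A `&` N).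

Lemma sub_locally_finite_set (X : topologicalType) (A B : set X) :
  A `<=` B -> locally_finite_set B -> locally_finite_set A.
Proof.
move=> AB lfB x; have [N xN finN] := lfB x; exists N => //.
by apply: sub_finite_set finN; exact: setSI.
Qed.

Lemma locally_finite_set_closed (X : topologicalType) (A : set X) :
  hausdorff_space X -> locally_finite_set A -> closed A.
Proof.
move=> hX lfA x clAx; have [N xN finN] := lfA x.
have clAN : closed (A `&` N).
  exact: (accessible_finite_set_closed.1 (hausdorff_accessible hX)).
suff : (A `&` N) x by case.
apply: clAN => M xM; rewrite -setIA; apply: clAx; exact: filterI.
Qed.

(** * One-point extensions attached to a closed discrete set *)

(** A copy of [option X] that carries the topology determined by [A]; [None] is
    the added point. *)
Definition one_point_along (X : topologicalType) (A : set X) : Type := option X.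

Section OnePointAlong.
Context {X : topologicalType} (A : set X).
Local Notation Y := (one_point_along A).

HB.instance Definition _ := Choice.on Y.

Definition along_open (W : set Y) := open (Some @^-1` W) /\
  (W None ->
    finite_set (A `\` Some @^-1` W) /\ sigma_bounded (~` (Some @^-1` W))).

Let along_openT : along_open setT.
Proof.
split; first by rewrite preimage_setT; exact: openT.
move=> _; rewrite preimage_setT setDT setCT; split=> //.
by exists (fun=> set0) => // _; exact: compact0.
Qed.

Let along_openI : setI_closed along_open.
Proof.
move=> V W [oV NV] [oW NW]; split; first by rewrite preimage_setI; exact: openI.
move=> [/NV[fV sV] /NW[fW sW]]; rewrite preimage_setI setDIr finite_setU setCI.
by split=> //; exact: sigma_boundedU.
Qed.

Let along_open_bigU (I : Type) (f : I -> set Y) :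
  (forall i, along_open (f i)) -> along_open (\bigcup_i f i).
Proof.
move=> of_; split.
  by rewrite preimage_bigcup; apply: bigcup_open => i _; have [] := of_ i.
move=> [i _ /(of_ i).2[fi si]].
have sub : Some @^-1` f i `<=` Some @^-1` (\bigcup_i f i) by move=> x; exists i.
split; first by apply: sub_finite_set fi => x [Ax nfx]; split=> // /sub.
by apply: sub_sigma_bounded si; exact: subsetC.
Qed.

HB.instance Definition _ :=
  isOpenTopological.Build Y along_openT along_openI along_open_bigU.

Lemma along_openE (W : set Y) : open W = along_open W.
Proof. by []. Qed.

Lemma along_closedP (C : set X) :
  closed C -> finite_set (A `&` C) -> sigma_bounded C ->
  closed (Some @` C : set Y).
Proof.
move=> clC finC sC; rewrite -openC along_openE.
have E : Some @^-1` (~` (Some @` C : set Y)) = ~` C.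
  apply/seteqP; split=> x; first by move=> nC Cx; apply: nC; exists x.
  by move=> nC [y Cy [yx]]; apply: nC; rewrite -yx.
by split; rewrite E; [rewrite openC | move=> _; rewrite setDE setCK].
Qed.

Lemma along_open_Some (U : set X) : open U -> open (Some @` U : set Y).
Proof.
move=> oU; rewrite along_openE; split; last by case.
suff -> : Some @^-1` (Some @` U : set Y) = U by [].
by apply/seteqP; split=> x; [case=> y Uy [<-]|move=> Ux; exists x].
Qed.

Lemma along_embedding : embedding (Some : X -> Y).
Proof.
split; first by move=> x y [].
move=> U; split=> [oU|[V [oV _] ->//]].
exists (Some @` U); first exact: along_open_Some.
by apply/seteqP; split=> x; [move=> Ux; exists x|case=> y Uy [<-]].
Qed.

Lemma along_Some_continuous : continuous (Some : X -> Y).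
Proof.
by apply/continuousP => W; rewrite along_openE => -[].
Qed.

Lemma along_dense : infinite_set A -> dense (range (Some : X -> Y)).
Proof.
move=> infA O [[x|] Ox] oO; first by exists (Some x); split=> //; exists x.
have [_ /(_ Ox)[fO _]] := oO.
have /infinite_setN0[x [Ax Ox']] : infinite_set (A `&` Some @^-1` O).
  by move=> fO'; apply: infA; rewrite -(setUIDK A (Some @^-1` O)) finite_setU.
by exists (Some x); split=> //; exists x.
Qed.

Lemma along_point : ~` range (Some : X -> Y) = [set None].
Proof.
apply/seteqP; split=> [[x|]//=|_ -> [x]//].
by case; exists x.
Qed.

Section Separation.
Hypotheses (hX : hausdorff_space X) (nX : normal_space X).
Hypotheses (lcX : locally_compact [set: X]) (lfA : locally_finite_set A).

(** Put [C] in an open set [O] covered by countably many compact sets, and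
    shrink within [O] while also avoiding the points of [A] outside [C]. The
    closure in [X] of the result then contains finitely many points of [A] and
    stays inside [O], so it is closed in the extension as well. *)
Let along_shrink (C N : set Y) : closed C -> ~ C None -> open N -> C `<=` N ->
  exists W, [/\ open W, C `<=` W & closure W `<=` N].
Proof.
move=> clC nC oN CN; pose C' := Some @^-1` C.
have [oC' /(_ nC)[finC sC]] : along_open (~` C) by rewrite -along_openE openC.
have clC' : closed C' by rewrite -openC.
have {}sC : sigma_bounded C' by apply: sub_sigma_bounded sC; rewrite setCK.
have {}finC : finite_set (A `&` C').
  by move: finC; rewrite setDE preimage_setC setCK.
have [O [oO CO sO]] := sigma_bounded_nbhs lcX sC.
have clAC : closed (A `\` C').
  apply: locally_finite_set_closed => //.
  by apply: sub_locally_finite_set lfA; exact: subDsetl.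
have [|x|W [oW CW WG]] := @normal_shrink X C'
    (Some @^-1` N `&` O `&` ~` (A `\` C')) nX clC'.
- by apply: openI; [apply: openI => //; case: oN|rewrite openC].
- move=> Cx; split; first by split; [exact: CN|exact: CO].
  by case.
exists (Some @` W); split.
- exact: along_open_Some.
- by move=> [x|//] Cx; exists x => //; exact: CW.
- apply: (@subset_trans _ (Some @` closure W)); last first.
    by move=> _ [x /WG[[? _] _] <-].
  have /closure_id -> : closed (Some @` closure W : set Y).
    apply: along_closedP; first exact: closed_closure.
      apply: sub_finite_set finC => x [Ax /WG[_ nAC]]; split=> //.
      by apply: contrapT => nCx; apply: nAC.
    by apply: sub_sigma_bounded sO => x /WG[[]].
  by apply: (@closureS Y); apply: image_subset; exact: subset_closure.
Qed.

(** Of a closed set and the complement of a neighbourhood of it, at least one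
    misses [None]; [along_shrink] applies to that one. *)
Lemma along_normal : normal_space Y.
Proof.
move=> C clC N /set_nbhsP[O [oO CO ON]].
suff [W [oW CW WO]] : exists W, [/\ open W, C `<=` W & closure W `<=` O].
  exists W; last exact: subset_trans ON.
  by apply/set_nbhsP; exists W; split.
have [CNone|] := pselect (C None); last by move/along_shrink; apply.
have [||||W [oW OW WC]] := @along_shrink (~` O) (~` C).
- by rewrite closedC.
- by apply; exact: CO.
- by rewrite openC.
- exact: subsetC.
exists (~` closure W); split.
- by rewrite openC; exact: closed_closure.
- by move=> x Cx /WC; apply.
- apply: (@subset_trans _ (~` W)).
    have /closure_id {1}-> : closed (~` W) by rewrite closedC.
    by apply: closureS; apply: subsetC; exact: subset_closure.
  by move=> x nWx; apply: contrapT => /OW.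
Qed.

Lemma along_closed1 (y : Y) : closed [set y].
Proof.
case: y => [x|].
  suff -> : [set Some x] = Some @` [set x] :> set Y.
    apply: along_closedP; last 2 first.
    - by apply: finite_setI; right; exact: finite_set1.
    - by exists (fun=> [set x]) => [_|_ ->]; [exact: compact_set1|exists 0%N].
    exact: (accessible_closed_set1 (hausdorff_accessible hX)).
  by rewrite image_set1.
rewrite -openC -along_point setCK along_openE; split; last by case.
suff -> : Some @^-1` range (Some : X -> Y) = setT by exact: openT.
by apply/seteqP; split=> // x _; exists x.
Qed.

Lemma along_tychonoff : tychonoff_space Y.
Proof. exact: normal_T1_tychonoff along_normal along_closed1. Qed.

End Separation.

(** One member of the cover contains [None]; what it leaves out is covered by
    countably many compact sets, each of them covered by finitely many
    members. *)
Lemma along_lindelof : lindelof_space Y.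
Proof.
move=> U oU; have [opU covU] := oU.
have [P UP PNone] : (\bigcup_(A in U) A) None by rewrite covU.
have [_ /(_ PNone)[_ [K cK PK]]] := opU _ UP.
have /choice[u Hu] : forall n, exists u : nat -> set Y,
    (forall m, U (u m)) /\ Some @` K n `<=` \bigcup_m u m.
  move=> n; have [||u] := @compact_seq_subcover Y U (Some @` K n) oU.
  - by exists P.
  - apply: continuous_compact => //; apply: continuous_subspaceT.
    exact: along_Some_continuous.
  - by exists u.
exists (P |` range (fun nm : nat * nat => u nm.1 nm.2)); split.
- by move=> _ [->//|[[n m] _ <-]]; have [] := Hu n.
- split=> [_ [->|[[n m] _ <-]]|]; first exact: opU.
    by apply: opU; have [] := Hu n.
  apply/seteqP; split=> // -[x|] _; last by exists P => //; left.
  have [Px|/PK[n _ Kx]] := pselect (P (Some x)); first by exists P => //; left.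
  have [_ /(_ (Some x))[|m _ ux]] := Hu n; first by exists x.
  by exists (u n m) => //; right; exists (n, m).
- rewrite -bigcup2E; apply: bigcup_countable => // -[|[|n]] _ //=.
  by apply: (card_le_trans (card_image_le _ _)); exact: countableP.
Qed.

End OnePointAlong.

Definition along_extension (X : topologicalType) (A : set X)
    (hX : hausdorff_space X) (nX : normal_space X)
    (lcX : locally_compact [set: X]) (lfA : locally_finite_set A)
    (infA : infinite_set A) : one_point_extension X :=
  OnePointExtension (along_tychonoff hX nX lcX lfA) (along_embedding A)
    (along_dense infA) (ex_intro _ None (along_point A)).

(** What makes extensions inequivalent. The map [f] must send [None] to [None];
    the complement of [B] is a neighbourhood of [None] for [A'], hence also for
    [A], and then it contains all but finitely many points of [A]. *)
Lemma continuous_along_finite (X : topologicalType) (A A' B : set X)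
    (f : one_point_along A -> one_point_along A') :
  continuous f -> injective f -> (forall x, f (Some x) = Some x) ->
  closed B -> sigma_bounded B -> B `<=` A -> A' `&` B = set0 -> finite_set B.
Proof.
move=> cf fI fS clB sB BA A'B.
have fN : f None = None.
  by case E : (f None) => [x|//]; have /fI := etrans E (esym (fS x)).
have : open (~` (Some @` B : set (one_point_along A'))).
  by rewrite openC; apply: along_closedP => //; rewrite A'B.
move/continuousP: cf => /[apply]; rewrite along_openE => -[_].
move=> /(_ _)[|+ _]; first by rewrite /= fN => -[].
apply: sub_finite_set => x Bx; split; first exact: BA.
by rewrite /= fS; apply; exists x.
Qed.

(** * Absorption of a countable factor *)

Lemma card_le_fun (T U : Type) (A : set T) (B : set U) : B !=set0 ->
  A #<= B -> exists f : T -> U, set_fun A B f /\ set_inj A f.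
Proof.
move=> [u _].
pose pU : pointedType := HB.pack {classic U} (isPointed.Build {classic U} u).
move=> /(@pcard_leP _ pU)[f]; exists f; split; first exact: funS.
by move=> x y; exact: inj.
Qed.

Lemma fun_card_le (T U : Type) (A : set T) (B : set U) (f : T -> U) :
  set_fun A B f -> set_inj A f -> A #<= B.
Proof.
move=> fAB fI; rewrite -(card_le_eql (inj_card_eq fI)).
by apply: subset_card_le => _ [x /fAB ? <-].
Qed.

Definition disjoint_sequences (T : Type) (D : set T) (F : set (nat -> T)) :=
  (forall f, F f -> injective f /\ range f `<=` D) /\
  (forall f g m n, F f -> F g -> f m = g n -> f = g).

(** An infinite remainder would contain one more sequence, against
    maximality. *)
Lemma maximal_disjoint_sequences (T : Type) (D : set T) :
  exists2 F, disjoint_sequences D F &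
    finite_set (D `\` \bigcup_(f in F) range f).
Proof.
have [F [dF maxF]] : exists F, disjoint_sequences D F /\
    forall G, F `<` G -> ~ disjoint_sequences D G.
  apply: Zorn_bigcup => S SP Stot; split.
    by move=> f [F /SP[+ _] Ff]; exact.
  move=> f g m n [F SF Ff] [G SG Gg].
  case: (Stot _ _ SF SG) => sub.
    by have [_] := SP _ SG; apply=> //; exact: sub.
  by have [_] := SP _ SF; apply=> //; exact: sub.
exists F => //; apply: contrapT => /infiniteP le.
have [f0 [f0D f0I]] : exists f : nat -> T,
    set_fun [set: nat] (D `\` \bigcup_(f in F) range f) f /\
    set_inj [set: nat] f.
  by apply: card_le_fun => //; apply: infinite_setN0; exact/infiniteP.
have nF : ~ F f0.
  by move=> Ff0; have [_] := f0D 0%N I; apply; exists f0 => //; exists 0%N.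
apply: (maxF (f0 |` F)).
  by split=> [f|/(_ f0)]; [right|move=> /(_ (or_introl erefl))].
have [F1 F2] := dF; split.
  move=> f [->|/F1//]; split; first by move=> x y /f0I; apply; rewrite in_setT.
  by move=> _ [n _ <-]; have [] := f0D n I.
move=> f g m n [->|Ff] [->|Gg] //.
- move=> e; have [_] := f0D m I; case; exists g => //; exists n => //.
- move=> e; have [_] := f0D n I; case; exists f => //; exists m => //.
- exact: F2.
Qed.

(** Up to a finite set, [D] is a disjoint union of sequences, that is, [F] times
    nat for a set [F] of sequences. A further factor nat is absorbed by the
    index of the sequences, which also leaves room to enumerate the finite
    remainder. *)
Lemma card_le_setX_nat (T : Type) (D : set T) :
  infinite_set D -> D `*` [set: nat] #<= D.
Proof.
move=> infD; have [F [F1 F2] finR] := maximal_disjoint_sequences D.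
set R := D `\` _ in finR.
have [f0 Ff0] : F !=set0.
  apply/set0P/eqP => F0; apply: infD; apply: sub_finite_set finR => x Dx.
  by split=> //; rewrite F0 bigcup_set0.
have [r Rr] : exists r : nat -> T, R `<=` range r.
  have [->|/set0P[x0 Rx0]] := eqVneq R set0; first by exists (fun=> f0 0%N).
  have [g [_ gI]] : exists g : T -> nat,
      set_fun R [set: nat] g /\ set_inj R g.
    by apply: card_le_fun; [exists 0%N|exact: finite_set_countable].
  have /choice[r Hr] : forall k, exists y, forall x, R x -> g x = k -> x = y.
    move=> k; have [[y [Ry gy]]|no] := pselect (exists y, R y /\ g y = k).
      by exists y => x Rx gx; apply: gI; [exact: mem_set..|rewrite gx].
    by exists x0 => x Rx gx; case: no; exists x.
  by exists r => x Rx; exists (g x) => //; apply/esym/Hr.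
(* [h] maps F x nat onto D x nat; the boolean in the code of the index tells
   terms of the sequence from points of the remainder. *)
pose h (fn : (nat -> T) * nat) : T * nat :=
  match choice.unpickle fn.2 : option (bool * (nat * nat)) with
  | Some (true, (k, m)) => (fn.1 k, m)
  | Some (false, (k, m)) => (r k, m)
  | None => (f0 0%N, 0%N)
  end.
apply: (@card_le_trans _ _ _ (F `*` [set: nat])).
  apply: (card_le_trans _ (card_image_le h _)); apply: subset_card_le.
  move=> [x m] [/= Dx _].
  have [[f Ff [k _ fk]]|nx] := pselect ((\bigcup_(f in F) range f) x).
    exists (f, choice.pickle (true, (k, m))) => //.
    by rewrite /h /= choice.pickleK fk.
  have [k _ rk] : range r x by apply: Rr.
  exists (f0, choice.pickle (false, (k, m))) => //.
  by rewrite /h /= choice.pickleK rk.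
apply: (@fun_card_le _ _ _ _ (fun fn : (nat -> T) * nat => fn.1 fn.2)).
  by move=> [f n] [/= /F1[_ fD] _]; apply: fD; exists n.
move=> [f m] [g n] /set_mem[/= Ff _] /set_mem[/= Fg _] e.
have fg := F2 _ _ _ _ Ff Fg e; rewrite -fg in e *.
by have [/(_ _ _ e)->] := F1 _ Ff.
Qed.

(** * A closed discrete set as large as the Lindelöf number *)

(** Choose a point [pt B] in each member [B] of a locally finite cover by
    relatively compact open sets. A point [d] is chosen for finitely many
    members only, so that the union [K d] of the compact sets enclosing them is
    compact; these sets cover [X], and countably many members of an open cover
    suffice for each. *)
Lemma exists_large_closed_discrete (X : topologicalType) :
  locally_compact [set: X] -> paracompact_space X -> ~ compact [set: X] ->
  exists D : set X, [/\ locally_finite_set D, infinite_set D &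
    subcover_bound X (D `*` [set: nat])].
Proof.
move=> lcX [_ pcX] ncX.
have [x0 _] : [set: X] !=set0.
  by apply/set0P/eqP => X0; apply: ncX; rewrite X0; exact: compact0.
have /pcX[V [[oV covV] refV lfV]] :
    open_cover [set U : set X | open U /\ exists2 K, compact K & U `<=` K].
  split; first by move=> U [].
  apply/seteqP; split=> // x _; have [K xK cK] := locally_compact_nbhs x lcX.
  exists K°; last exact: nbhs_singleton (nbhs_interior xK).
  by split; [exact: open_interior|exists K => //; exact: interior_subset].
pose V0 := [set B | V B /\ B !=set0].
have /choice[c Hc] : forall B, exists K, V B -> compact K /\ B `<=` K.
  move=> B; have [/refV[U [_ [K cK UK]] BU]|nVB] := pselect (V B).
    by exists K => _; split=> //; exact: subset_trans UK.
  by exists set0.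
have /choice[pt Hpt] : forall B : set X, exists x, B !=set0 -> B x.
  by move=> B; have [[x Bx]|n] := pselect (B !=set0); [exists x|exists x0].
pose D := pt @` V0.
pose S d := [set B | V0 B /\ pt B = d].
pose K d := \bigcup_(B in S d) c B.
have cK d : compact (K d).
  have [N dN finN] := lfV d; apply: compact_bigcup_finite.
    apply: sub_finite_set finN => B [[VB B0] ptB]; split=> //.
    by exists d; split; [rewrite -ptB; exact: Hpt|exact: nbhs_singleton].
  by move=> B [[/Hc[]]].
have covK : \bigcup_(d in D) K d = [set: X].
  apply/seteqP; split=> // x _.
  have [B VB Bx] : (\bigcup_(B in V) B) x by rewrite covV.
  have V0B : V0 B by split=> //; exists x.
  exists (pt B); first by exists B.
  by exists B => //; have [_] := Hc _ VB; apply.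
exists D; split.
- move=> x; have [N xN finN] := lfV x; exists N => //.
  apply: sub_finite_set (finite_image pt finN) => _ [[B [VB B0] <-] Nx].
  by exists B => //; split=> //; exists (pt B); split=> //; exact: Hpt.
- by move=> finD; apply: ncX; rewrite -covK; apply: compact_bigcup_finite.
- move=> U oU; have [opU covU] := oU.
  have U0 : U !=set0.
    have [A UA _] : (\bigcup_(A in U) A) x0 by rewrite covU.
    by exists A.
  have /choice[u Hu] : forall d, exists u : nat -> set X,
      (forall n, U (u n)) /\ K d `<=` \bigcup_n u n.
    by move=> d; have [u] := compact_seq_subcover oU U0 (cK d); exists u.
  exists ((fun dn : X * nat => u dn.1 dn.2) @` (D `*` [set: nat])).
  have sub : (fun dn : X * nat => u dn.1 dn.2) @` (D `*` [set: nat]) `<=` U.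
    by move=> _ [[d n] _ <-]; have [] := Hu d.
  split=> //; last exact: card_image_le.
  split; first by move=> A /sub /opU.
  apply/seteqP; split=> // x _.
  have [d Dd Kx] : (\bigcup_(d in D) K d) x by rewrite covK.
  have [_ /(_ _ Kx)[n _ ux]] := Hu d.
  by exists (u d n) => //; exists (d, n).
Qed.

Lemma exists_discrete_sequences (X : topologicalType) :
  locally_compact [set: X] -> paracompact_space X -> ~ compact [set: X] ->
  exists2 D : set X, locally_finite_set D &
    exists j : (set X + nat) * nat -> X,
      set_fun (lindelof_number X `*` [set: nat]) D j /\
      set_inj (lindelof_number X `*` [set: nat]) j.
Proof.
move=> lcX pcX ncX.
have [D [lfD infD coverD]] := exists_large_closed_discrete lcX pcX ncX.
exists D => //.
have [_ _ minL] := lindelof_numberP X.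
set L := lindelof_number X in minL *.
have leLD : L #<= D.
  apply: (card_le_trans _ (card_le_setX_nat infD)); apply: minL => //.
  apply/infiniteP; apply: (card_le_trans ((infiniteP _).1 infD)).
  apply: (@fun_card_le _ _ _ _ (fun x => (x, 0%N))) => [x Dx //|].
  by move=> x y _ _ [].
have D0 := infinite_setN0 infD.
have [i [iD iI]] := card_le_fun D0 leLD.
have [k [kD kI]] := card_le_fun D0 (card_le_setX_nat infD).
exists (fun ln => k (i ln.1, ln.2)); split.
  by move=> [l n] [/= Ll _]; apply: kD; split=> //; exact: iD.
move=> [l m] [l' n] /set_mem[/= Ll _] /set_mem[/= Ll' _] e.
have /= := kI (i l, m) (i l', n) (mem_set (conj (iD _ Ll) I))
  (mem_set (conj (iD _ Ll') I)) e.
by case=> ill' ->; rewrite (iI l l') //; exact: mem_set.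
Qed.

(** * Many inequivalent extensions *)

Lemma ope_equiv_refl (X : topologicalType) (Y : one_point_extension X) :
  ope_equiv Y Y.
Proof. by exists idfun, idfun; split=> // x; exact: cvg_id. Qed.

Theorem theorem6p1 (X : topologicalType)
  (locally_compact_X : locally_compact_space X)
  (paracompact_X : paracompact_space X)
  (noncompact_X : ~ compact [set: X]) :
  large_card_le [set B | B `<=` lindelof_number X]
    (@lindelof_ope_classes X).
Proof.
have [hX lcX] := locally_compact_X.
have nX := paracompact_normal paracompact_X.
have [D lfD [j [jD jI]]] :=
  exists_discrete_sequences lcX paracompact_X noncompact_X.
have [infL _ _] := lindelof_numberP X.
set L := lindelof_number X in infL jD jI *.
have [l0 Ll0] := infinite_setN0 infL.
have jinj l l' m n : L l -> L l' -> j (l, m) = j (l', n) -> l = l' /\ m = n.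
  move=> Ll Ll' e.
  by have [] := jI _ _ (mem_set (conj Ll I)) (mem_set (conj Ll' I)) e.
have jinf l (a : bool) : L l -> infinite_set (range (fun n => j (l, a + n.*2))).
  move=> Ll; apply/infiniteP.
  apply: (@fun_card_le _ _ _ _ (fun n => j (l, a + n.*2))).
    by move=> n _; exists n.
  by move=> m n _ _ /jinj[]// _ /addnI /double_inj.
(* The even terms, present for every [S], keep [A S] infinite even when [S] is
   empty. *)
pose A S := [set x | exists l n, [/\ L l, odd n -> S l & x = j (l, n)]].
have AD S : A S `<=` D by move=> _ [l [n [Ll _ ->]]]; exact: jD.
have lfA S : locally_finite_set (A S) by exact: sub_locally_finite_set lfD.
have infA S : infinite_set (A S).
  apply: sub_infinite_set (jinf l0 false Ll0) => _ [n _ <-].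
  by exists l0, n.*2; split=> //; rewrite odd_double.
pose Y S := along_extension hX nX lcX (lfA S) (infA S).
exists (fun S => ope_equiv (Y S)); split.
  by move=> S _; exists (Y S) => //; exact: along_lindelof.
move=> S S' /= SL S'L YSS'.
have equiv1 : ope_equiv (Y S) (Y S') by rewrite YSS'; exact: ope_equiv_refl.
have equiv2 : ope_equiv (Y S') (Y S) by rewrite -YSS'; exact: ope_equiv_refl.
have sub S1 S2 : S1 `<=` L -> ope_equiv (Y S1) (Y S2) -> S1 `<=` S2.
  move=> S1L [f [g [cf _ fK _ fS]]] l S1l; have Ll := S1L _ S1l.
  apply: contrapT => nS2l.
  pose B := range (fun n => j (l, true + n.*2)).
  apply: (jinf l true Ll); rewrite -/B.
  have BA : B `<=` A S1 by move=> _ [n _ <-]; exists l, (true + n.*2)%N.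
  apply: (@continuous_along_finite X (A S1) (A S2) B f) => //.
  - exact: can_inj fK.
  - apply: (locally_finite_set_closed hX); apply: sub_locally_finite_set lfD.
    by apply: subset_trans BA _; exact: AD.
  - exact: range_sigma_bounded.
  - apply/disjoints_subset => _ [l' [m [Ll' oddS ->]]] [n _ /jinj[]// ll' nm].
    by apply: nS2l; rewrite ll'; apply: oddS; rewrite -nm /= odd_double.
by apply/seteqP; split; exact: sub.
Qed.
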